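(* Let $X$ be a set and let $\varphi\in\mathrm{Aut}(\mathcal{IP}_X)$. Then there is $g\in\mathcal{S}_X$ such that $\varphi=\varphi_g$, where $\varphi_g(a)=g^{-1}ag$ for every $a\in\mathcal{IP}_X$. In particular, $\mathrm{Aut}(\mathcal{IP}_X)\cong\mathcal{S}_X$ when $|X|\neq 2$, and $\mathrm{Aut}(\mathcal{IP}_2)$ is trivial.
   Context: Let $X$ be an arbitrary set and let $X'=\{x':x\in X\}$ be a disjoint copy of $X$, with $x\mapsto x'$ a fixed bijection $X\to X'$; the inverse bijection is also denoted by $'$. Let $\mathcal{CS}_X$ be the set of all partitions of $X\cup X'$ into nonempty blocks. For $a\in\mathcal{CS}_X$ write $x\equiv_a y$ if $x,y\in X\cup X'$ lie in the same block of $a$. The product $ab$ of $a,b\in\mathcal{CS}_X$ is the partition corresponding to the equivalence relation $\equiv$ on $X\cup X'$ defined, for $x,y\in X$, by: (i) $x\equiv y$ iff $x\equiv_a y$ or there are $s\ge 1$ and $c_1,\dots,c_{2s}\in X$ with $x\equiv_a c_1'$, $c_1\equiv_b c_2$, $c_2'\equiv_a c_3'$, $\dots$, $c_{2s-1}\equiv_b c_{2s}$, $c_{2s}'\equiv_a y$; (ii) $x'\equiv y'$ iff $x'\equiv_b y'$ or there are $s\ge 1$ and $c_1,\dots,c_{2s}\in X$ with $x'\equiv_b c_1$, $c_1'\equiv_a c_2'$, $c_2\equiv_b c_3$, $\dots$, $c_{2s-1}'\equiv_a c_{2s}'$, $c_{2s}\equiv_b y'$; (iii) $x\equiv y'$ iff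 $y'\equiv x$ iff there are $s\ge 1$ and $c_1,\dots,c_{2s-1}\in X$ with $x\equiv_a c_1'$, $c_1\equiv_b c_2$, $c_2'\equiv_a c_3'$, $\dots$, $c_{2s-2}'\equiv_a c_{2s-1}'$, $c_{2s-1}\equiv_b y'$. With this product $\mathcal{CS}_X$ is a semigroup, and $\mathcal{IP}_X$ is the subsemigroup of all $a\in\mathcal{CS}_X$ each of whose blocks meets both $X$ and $X'$. For $X=\{1,\dots,n\}$ write $\mathcal{IP}_n$. The symmetric group $\mathcal{S}_X$ (permutations multiplied left to right, $(gh)(x)=h(g(x))$) is identified with a subgroup of $\mathcal{IP}_X$ via $g\mapsto\{\{x,g(x)'\}:x\in X\}$. $\mathrm{Aut}(\mathcal{IP}_X)$ is the group of semigroup automorphisms of $\mathcal{IP}_X$. *)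

(* Defs.v *)
From HB Require Import structures.
From mathcomp Require Import all_boot all_classical.
From mathcomp Require Import zify.

Set Implicit Arguments.
Unset Strict Implicit.
Unset Printing Implicit Defensive.

Local Open Scope classical_set_scope.

(* The disjoint union of X and its copy X' is rendered as X + X : a point x   *)
(* of X is [inl x] and its copy x' is [inr x].                                *)
Record CS (X : Type) : Type := MkCS {
  blocks : set (set (X + X));
  blocksP : partition blocks id [set: X + X]
}.

HB.instance Definition _ (X : Type) := gen_eqMixin (CS X).
HB.instance Definition _ (X : Type) := gen_choiceMixin (CS X).

Definition same_block (X : Type) (a : CS X) (u v : X + X) : Prop :=
  exists2 B, blocks a B & B u /\ B v.

Section product_relation.
Variables (X : Type) (a b : CS X).

(* In the three definitions below only the values of c at 1, ..., 2 s (resp.  *)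
(* 1, ..., 2 s - 1) matter; a finite sequence of points of X with s >= 1 can  *)
(* always be extended to nat, as X is then inhabited.                         *)

(* x a c_1', c_1 b c_2, c_2' a c_3', ..., c_{2s-1} b c_{2s}, c_{2s}' a y *)
Definition mul_upper (x y : X) : Prop :=
  same_block a (inl x) (inl y) \/
  exists (s : nat) (c : nat -> X),
    [/\ 1 <= s,
        same_block a (inl x) (inr (c 1)),
        forall i, 1 <= i <= s ->
          same_block b (inl (c (2 * i - 1))) (inl (c (2 * i))),
        forall i, 1 <= i < s ->
          same_block a (inr (c (2 * i))) (inr (c (2 * i + 1)))
      & same_block a (inr (c (2 * s))) (inl y)].

(* x' b c_1, c_1' a c_2', c_2 b c_3, ..., c_{2s-1}' a c_{2s}', c_{2s} b y' *)
Definition mul_lower (x y : X) : Prop :=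
  same_block b (inr x) (inr y) \/
  exists (s : nat) (c : nat -> X),
    [/\ 1 <= s,
        same_block b (inr x) (inl (c 1)),
        forall i, 1 <= i <= s ->
          same_block a (inr (c (2 * i - 1))) (inr (c (2 * i))),
        forall i, 1 <= i < s ->
          same_block b (inl (c (2 * i))) (inl (c (2 * i + 1)))
      & same_block b (inl (c (2 * s))) (inr y)].

(* x a c_1', c_1 b c_2, c_2' a c_3', ..., c_{2s-2}' a c_{2s-1}', c_{2s-1} b y' *)
Definition mul_cross (x y : X) : Prop :=
  exists (s : nat) (c : nat -> X),
    [/\ 1 <= s,
        same_block a (inl x) (inr (c 1)),
        forall i, 1 <= i < s ->
          same_block b (inl (c (2 * i - 1))) (inl (c (2 * i))),
        forall i, 1 <= i < s ->
          same_block a (inr (c (2 * i))) (inr (c (2 * i + 1)))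
      & same_block b (inl (c (2 * s - 1))) (inr y)].

Definition mul_rel (u v : X + X) : Prop :=
  match u, v with
  | inl x, inl y => mul_upper x y
  | inr x, inr y => mul_lower x y
  | inl x, inr y => mul_cross x y
  | inr y, inl x => mul_cross x y
  end.

Definition mul_blocks : set (set (X + X)) :=
  [set [set v | mul_rel u v] | u in [set: X + X]].

End product_relation.

Section same_block_theory.
Variables (X : Type) (a : CS X).

Lemma same_block_refl u : same_block a u u.
Proof.
have [acov _ _] := blocksP a.
have : [set: X + X] u by [].
by rewrite -acov => -[B aB Bu]; exists B.
Qed.

Lemma same_block_sym u v : same_block a u v -> same_block a v u.
Proof. by move=> [B aB [Bu Bv]]; exists B. Qed.

Lemma same_block_trans v u w :
  same_block a u v -> same_block a v w -> same_block a u w.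
Proof.
move=> [B aB [Bu Bv]] [C aC [Cv Cw]]; exists B => //; split=> //.
have [_ atriv _] := blocksP a.
by rewrite (atriv B C aB aC) //; exists v.
Qed.

Lemma blocksE : blocks a = [set [set v | same_block a u v] | u in [set: X + X]].
Proof.
have [_ atriv ane] := blocksP a.
have blkE B u : blocks a B -> B u -> [set v | same_block a u v] = B.
  move=> aB Bu; apply/seteqP; split=> [v [C aC [Cu Cv]]|v Bv]; last by exists B.
  by rewrite (atriv B C aB aC) //; exists u.
apply/seteqP; split=> [B aB|_ [u _ <-]].
  by have [u Bu] := ane B aB; exists u => //; exact: blkE.
by have [B aB [Bu _]] := same_block_refl u; rewrite (blkE B u).
Qed.

End same_block_theory.

Lemma CS_eq (X : Type) (a b : CS X) : blocks a = blocks b -> a = b.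
Proof.
case: a b => [P Pp] [Q Qp] /= E; subst Q.
by congr MkCS; exact: Prop_irrelevance.
Qed.

Lemma CS_ext (X : Type) (a b : CS X) :
  (forall u v, same_block a u v <-> same_block b u v) -> a = b.
Proof.
move=> ab; apply: CS_eq; rewrite !blocksE; congr image.
by apply/funext => u; apply/seteqP; split=> v /ab.
Qed.

Lemma partition_classes (T : Type) (R : T -> T -> Prop) :
  (forall u, R u u) -> (forall u v, R u v -> R v u) ->
  (forall v u w, R u v -> R v w -> R u w) ->
  partition [set [set v | R u v] | u in [set: T]] id [set: T].
Proof.
move=> Rr Rs Rt; split.
- apply/seteqP; split=> // u _; exists [set v | R u v]; last exact: Rr.
  by exists u.
- move=> _ _ [u _ <-] [v _ <-] [w [/= uw vw]].
  apply/seteqP; split=> z /= h.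
    exact: (Rt _ _ _ vw (Rt _ _ _ (Rs _ _ uw) h)).
  exact: (Rt _ _ _ uw (Rt _ _ _ (Rs _ _ vw) h)).
- by move=> _ [u _ <-]; exists u; exact: Rr.
Qed.

Section closure.
Variables (T : Type) (S : T -> T -> Prop).

Inductive clos (p : T) : T -> Prop :=
| clos_refl : clos p p
| clos_step q r : clos p q -> S q r -> clos p r.

Lemma clos1 p q : S p q -> clos p q.
Proof. by move=> pq; apply: clos_step pq; exact: clos_refl. Qed.

Lemma clos_trans q p r : clos p q -> clos q r -> clos p r.
Proof. by move=> pq; elim=> // s t _ ps st; exact: clos_step st. Qed.

Lemma clos_sym (Ss : forall p q, S p q -> S q p) p q : clos p q -> clos q p.
Proof.
elim=> [|r s _ rp rs]; first exact: clos_refl.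
by apply: clos_trans rp; apply: clos1; exact: Ss.
Qed.

End closure.

Lemma clos_map (T U : Type) (S : T -> T -> Prop) (S' : U -> U -> Prop)
    (f : T -> U) :
  (forall p q, S p q -> clos S' (f p) (f q)) ->
  forall p q, clos S p q -> clos S' (f p) (f q).
Proof.
move=> SS' p q; elim=> [|r s _ pr rs]; first exact: clos_refl.
by apply: clos_trans pr _; exact: SS'.
Qed.

Section alternating.
Variables (X : Type) (P Q : X -> X -> Prop).
Hypotheses (Pr : forall x, P x x) (Qr : forall x, Q x x).

Let J := clos (fun x y => P x y \/ Q x y).

Lemma alt_sound (f : nat -> X) n :
  1 <= n ->
  (forall i, 1 <= i -> 2 * i <= n -> P (f (2 * i - 1)) (f (2 * i))) ->
  (forall i, 1 <= i -> 2 * i + 1 <= n -> Q (f (2 * i)) (f (2 * i + 1))) ->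
  J (f 1) (f n).
Proof.
elim: n => // n IH _ hP hQ.
have [->|n0] := posnP n; first exact: clos_refl.
have Jn : J (f 1) (f n).
  by apply: IH => // i i1 ni; [apply: hP => //|apply: hQ => //]; lia.
apply: (clos_step Jn).
have [o|e] := boolP (odd n).
  left; have := hP (n.+1)./2.
  have -> : 2 * (n.+1)./2 - 1 = n by lia.
  have -> : 2 * (n.+1)./2 = n.+1 by lia.
  by apply; lia.
right; have := hQ n./2.
have -> : 2 * n./2 + 1 = n.+1 by lia.
have -> : 2 * n./2 = n by lia.
by apply; lia.
Qed.

Lemma alt_even x y : J x y -> exists (s : nat) (c : nat -> X),
  [/\ 1 <= s, c 1 = x, c (2 * s) = y,
   forall i, 1 <= i <= s -> P (c (2 * i - 1)) (c (2 * i)) &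
   forall i, 1 <= i < s -> Q (c (2 * i)) (c (2 * i + 1))].
Proof.
elim=> [|z w _ [s [c [s1 c1 cs hP hQ]]] zw].
  by exists 1, (fun=> x); split=> // i; lia.
have [v [zv vw]] : exists v, Q z v /\ P v w.
  by case: zw => h; [exists z|exists w].
exists s.+1, (fun i => if i <= 2 * s then c i else
   if i == 2 * s + 1 then v else w); split.
- by [].
- by have -> : 1 <= 2 * s by lia.
- have -> : (2 * s.+1 <= 2 * s) = false by lia.
  by have -> : (2 * s.+1 == 2 * s + 1) = false by lia.
- move=> i i1; have [iS|->] : i <= s \/ i = s.+1 by lia.
    have -> : 2 * i - 1 <= 2 * s by lia.
    have -> : 2 * i <= 2 * s by lia.
    by apply: hP; lia.
  have -> : (2 * s.+1 - 1 <= 2 * s) = false by lia.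
  have -> : (2 * s.+1 <= 2 * s) = false by lia.
  have -> : (2 * s.+1 == 2 * s + 1) = false by lia.
  by have -> : (2 * s.+1 - 1 == 2 * s + 1) by lia.
- move=> i i1; have [iS|->] : i < s \/ i = s by lia.
    have -> : 2 * i <= 2 * s by lia.
    have -> : 2 * i + 1 <= 2 * s by lia.
    by apply: hQ; lia.
  rewrite leqnn eqxx cs.
  by have -> : (2 * s + 1 <= 2 * s) = false by lia.
Qed.

Lemma alt_odd x y : J x y -> exists (s : nat) (c : nat -> X),
  [/\ 1 <= s, c 1 = x, c (2 * s - 1) = y,
   forall i, 1 <= i < s -> P (c (2 * i - 1)) (c (2 * i)) &
   forall i, 1 <= i < s -> Q (c (2 * i)) (c (2 * i + 1))].
Proof.
move=> /alt_even[s [c [s1 c1 cs hP hQ]]].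
exists s.+1, (fun i => if i <= 2 * s then c i else y); split.
- by [].
- by have -> : 1 <= 2 * s by lia.
- by have -> : (2 * s.+1 - 1 <= 2 * s) = false by lia.
- move=> i i1.
  have -> : 2 * i - 1 <= 2 * s by lia.
  have -> : 2 * i <= 2 * s by lia.
  by apply: hP; lia.
- move=> i i1; have [iS|->] : i < s \/ i = s by lia.
    have -> : 2 * i <= 2 * s by lia.
    have -> : 2 * i + 1 <= 2 * s by lia.
    by apply: hQ; lia.
  rewrite leqnn cs.
  by have -> : (2 * s + 1 <= 2 * s) = false by lia.
Qed.

End alternating.

(* Gluing of partitions: the copies of X are stacked in rows 0, 1, 2, ...,    *)
(* and a partition may relate points of two consecutive rows.                 *)
Section gluing.
Variable X : Type.
Implicit Types a b c : CS X.

Definition place (k l : nat) (u : X + X) : nat * X :=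
  match u with inl x => (k, x) | inr x => (l, x) end.

Definition glue_step k l a (p q : nat * X) : Prop :=
  exists u v, [/\ p = place k l u, q = place k l v & same_block a u v].

Definition glue2 k l m a b :=
  clos (fun p q => glue_step k l a p q \/ glue_step l m b p q).

Lemma glue_step_sym k l a p q : glue_step k l a p q -> glue_step k l a q p.
Proof.
by move=> [u [v [-> -> uv]]]; exists v, u; split=> //; exact: same_block_sym.
Qed.

Lemma glue_step_place k l a u v :
  same_block a u v -> glue_step k l a (place k l u) (place k l v).
Proof. by move=> uv; exists u, v. Qed.

Section mul_rel_glue.
Variables a b : CS X.

Let P x y := same_block b (inl x) (inl y).
Let Q x y := same_block a (inr x) (inr y).
Let J := clos (fun x y => P x y \/ Q x y).
Let J' := clos (fun x y => Q x y \/ P x y).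
Let G := glue2 0 1 2 a b.

Let Pr x : P x x. Proof. exact: same_block_refl. Qed.
Let Qr x : Q x x. Proof. exact: same_block_refl. Qed.

Let JJ' x y : J x y -> J' x y.
Proof.
by apply: (clos_map (f := id)) => p q; case=> h; apply: clos1; [right|left].
Qed.

Let J_sym x y : J x y -> J y x.
Proof. by apply: clos_sym => p q; case=> h; [left|right]; exact: same_block_sym. Qed.

Let link (u : X + X) (m : X) : Prop :=
  match u with
  | inl x => exists2 c, same_block a (inl x) (inr c) & J c m
  | inr y => exists2 c, same_block b (inr y) (inl c) & J c m
  end.

Let direct (u v : X + X) : Prop :=
  match u, v with
  | inl _, inl _ => same_block a u v
  | inr _, inr _ => same_block b u v
  | _, _ => False
  end.

Let G_sym p q : G p q -> G q p.
Proof. by apply: clos_sym => r s; case=> h; [left|right]; exact: glue_step_sym. Qed.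

Let Ga u v : same_block a u v -> G (place 0 1 u) (place 0 1 v).
Proof. by move=> uv; apply: clos1; left; exact: glue_step_place. Qed.

Let Gb u v : same_block b u v -> G (place 1 2 u) (place 1 2 v).
Proof. by move=> uv; apply: clos1; right; exact: glue_step_place. Qed.

Let GJ x y : J x y -> G (1, x) (1, y).
Proof.
apply: (clos_map (f := fun z => (1, z))) => p q [h|h]; first exact: (Gb h).
exact: (Ga h).
Qed.

Let G_link u m : link u m -> G (place 0 2 u) (1, m).
Proof.
by case: u => x [c xc /GJ cm]; apply: clos_trans cm; [exact: Ga xc|exact: Gb xc].
Qed.

Let mul_relE u v :
  mul_rel a b u v <-> direct u v \/ exists2 m, link u m & link v m.
Proof.
have cross x y : mul_cross a b x y <-> exists2 m, link (inl x) m & link (inr y) m.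
  split=> [[s [c [s1 xc hP hQ cy]]]|[m [c xc cm] [d yd dm]]].
    exists (c (2 * s - 1)); last first.
      by exists (c (2 * s - 1)); [exact: same_block_sym|exact: clos_refl].
    exists (c 1) => //; apply: alt_sound; first lia.
      by move=> i i1 i2; apply: hP; lia.
    by move=> i i1 i2; apply: hQ; lia.
  have /(alt_odd Pr Qr)[s [f [s1 f1 fs hP hQ]]] := clos_trans cm (J_sym dm).
  exists s, f; split=> //; first by rewrite f1.
  by rewrite fs; exact: same_block_sym.
case: u v => [x|x] [y|y] /=.
- split=> [[xy|[s [c [s1 xc hP hQ cy]]]]|[xy|[m [c xc cm] [d yd dm]]]];
    [by left|right|by left|right].
    exists (c (2 * s)); last first.
      by exists (c (2 * s)); [exact: same_block_sym|exact: clos_refl].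
    exists (c 1) => //; apply: alt_sound; first lia.
      by move=> i i1 i2; apply: hP; lia.
    by move=> i i1 i2; apply: hQ; lia.
  have /(alt_even Pr Qr)[s [f [s1 f1 fs hP hQ]]] := clos_trans cm (J_sym dm).
  exists s, f; split=> //; first by rewrite f1.
  by rewrite fs; exact: same_block_sym.
- by split=> [/cross|[//|/cross//]]; right.
- by split=> [/cross[m ? ?]|[//|[m ? ?]]]; [right; exists m|apply/cross; exists m].
- split=> [[xy|[s [c [s1 xc hP hQ cy]]]]|[xy|[m [c xc cm] [d yd dm]]]];
    [by left|right|by left|right].
    exists (c (2 * s)); last first.
      by exists (c (2 * s)); [exact: same_block_sym|exact: clos_refl].
    exists (c 1) => //.
    apply: (clos_map (S := fun x y => Q x y \/ P x y) (f := id)).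
      by move=> p q; case=> h; apply: clos1; [right|left].
    apply: alt_sound; first lia.
      by move=> i i1 i2; apply: hP; lia.
    by move=> i i1 i2; apply: hQ; lia.
  have /JJ'/(alt_even Qr Pr)[s [f [s1 f1 fs hP hQ]]] := clos_trans cm (J_sym dm).
  exists s, f; split=> //; first by rewrite f1.
  by rewrite fs; exact: same_block_sym.
Qed.

Lemma mul_relP u v : mul_rel a b u v <-> G (place 0 2 u) (place 0 2 v).
Proof.
rewrite mul_relE; split.
  case=> [|[m um vm]]; last first.
    by apply: clos_trans (G_link um) _; apply: G_sym; exact: G_link.
  by case: u v => [x|x] [y|y] //= h; [exact: Ga h|exact: Gb h].
pose inv w (p : nat * X) := match p with
  | (0, x) => direct w (inl x) \/ exists2 m, link w m & link (inl x) m
  | (1, m) => link w m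
  | (_, y) => direct w (inr y) \/ exists2 m, link w m & link (inr y) m
  end.
suff H p : G (place 0 2 u) p -> inv u p by move=> /H; case: v.
have linkJ w m n : link w m -> J m n -> link w n.
  by case: w => x [c xc cm] mn; exists c => //; exact: clos_trans mn.
elim=> [|q r _].
  by case: u => x; left; exact: same_block_refl.
rewrite /inv; move=> hq [[[x|x] [[y|y] [qE rE]]]|[[x|x] [[y|y] [qE rE]]]] xy;
  move: hq; rewrite {}qE {}rE /=.
- case=> [|[m um [c xc cm]]].
    by case: u => // z zx; left; exact: same_block_trans zx xy.
  right; exists m => //; exists c => //.
  by apply: same_block_trans xc; exact: same_block_sym.
- case=> [|[m um [c xc cm]]].
    case: u => // z zx; exists y; last exact: clos_refl.
    exact: same_block_trans zx xy.
  apply: (linkJ _ _ _ um); apply: J_sym; apply: clos_trans cm.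
  apply: clos1; right; apply: same_block_trans xc; exact: same_block_sym.
- move=> ux; right; exists x => //; exists x; last exact: clos_refl.
  exact: same_block_sym.
- by move=> ux; apply: (linkJ _ _ _ ux); apply: clos1; right.
- by move=> ux; apply: (linkJ _ _ _ ux); apply: clos1; left.
- move=> ux; right; exists x => //; exists x; last exact: clos_refl.
  exact: same_block_sym.
- case=> [|[m um [c xc cm]]].
    case: u => // z zx; exists y; last exact: clos_refl.
    exact: same_block_trans zx xy.
  apply: (linkJ _ _ _ um); apply: J_sym; apply: clos_trans cm.
  apply: clos1; left; apply: same_block_trans xc; exact: same_block_sym.
- case=> [|[m um [c xc cm]]].
    by case: u => // z zx; left; exact: same_block_trans zx xy.
  right; exists m => //; exists c => //.
  by apply: same_block_trans xc; exact: same_block_sym.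
Qed.

Lemma mul_blocksP : partition (mul_blocks a b) id [set: X + X].
Proof.
apply: partition_classes => [u|u v|v u w]; rewrite !mul_relP.
- exact: clos_refl.
- exact: G_sym.
- exact: clos_trans.
Qed.

End mul_rel_glue.

Definition mulCS a b : CS X := MkCS (mul_blocksP a b).

Lemma same_block_mul a b u v : same_block (mulCS a b) u v <-> mul_rel a b u v.
Proof.
split.
  move=> [_ [w _ <-] [/= /mul_relP wu /mul_relP wv]]; apply/mul_relP.
  apply: clos_trans wv; apply: clos_sym wu => p q.
  by case=> h; [left|right]; exact: glue_step_sym.
move=> uv; exists [set v | mul_rel a b u v]; first by exists u.
by split=> //=; apply/mul_relP; exact: clos_refl.
Qed.

Let reindex (f : nat -> nat) (p : nat * X) := (f p.1, p.2).

Let glue2_reindex f k l m a b p q :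
  glue2 k l m a b p q ->
  glue2 (f k) (f l) (f m) a b (reindex f p) (reindex f q).
Proof.
apply: clos_map => {}p {}q h; apply: clos1.
by case: h => -[[x|x] [[y|y] [-> -> xy]]]; [left|left|left|left|right|right|right|right];
  [exists (inl x), (inl y)|exists (inl x), (inr y)|exists (inr x), (inl y)
  |exists (inr x), (inr y)|exists (inl x), (inl y)|exists (inl x), (inr y)
  |exists (inr x), (inl y)|exists (inr x), (inr y)].
Qed.

Lemma same_block_mul_glue k l m a b u v : k != l -> l != m -> k != m ->
  same_block (mulCS a b) u v <-> glue2 k l m a b (place k m u) (place k m v).
Proof.
move=> /eqP kl /eqP lm /eqP km; rewrite same_block_mul mul_relP; split=> h.
  pose f i := if i == 0 then k else if i == 1 then l else m.
  by have := glue2_reindex f h; case: u {h} => x; case: v => y.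
pose f i := if i == k then 0 else if i == l then 1 else 2.
have := glue2_reindex f h; rewrite /reindex.
have -> : f k = 0 by rewrite /f eqxx.
have -> : f l = 1 by rewrite /f; case: eqP => [?|_]; [congruence|rewrite eqxx].
have -> : f m = 2 by rewrite /f; case: eqP => [?|_]; [congruence|case: eqP => [?|//]; congruence].
have fp w : (f (place k m w).1, (place k m w).2) = place 0 2 w.
  case: w => z /=; first by rewrite /f eqxx.
  by rewrite /f; case: eqP => [?|_]; [congruence|case: eqP => [?|//]; congruence].
by rewrite !fp.
Qed.

Let glue3 a b c := clos (fun p q =>
  [\/ glue_step 0 1 a p q, glue_step 1 2 b p q | glue_step 2 3 c p q]).

Let mulCS_left a b c u v : same_block (mulCS (mulCS a b) c) u v <->
  glue3 a b c (place 0 3 u) (place 0 3 v).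
Proof.
rewrite (@same_block_mul_glue 0 2 3) //; split.
  apply: (clos_map (f := id)) => p q [[x [y [-> -> xy]]]|h]; last first.
    by apply: clos1; constructor 3.
  move/(@same_block_mul_glue 0 1 2 _ _ _ _ isT isT isT): xy.
  apply: (clos_map (f := id)) => r s [h|h]; apply: clos1.
    by constructor 1.
  by constructor 2.
set G := glue2 0 2 3 _ _.
pose inv p := (exists2 w, G (place 0 3 u) (place 0 2 w) &
                 glue2 0 1 2 a b (place 0 2 w) p) \/
   (exists2 w, p = place 2 3 w & G (place 0 3 u) p).
have inv1 p : inv p -> p.1 < 3 -> exists2 w, G (place 0 3 u) (place 0 2 w) &
                 glue2 0 1 2 a b (place 0 2 w) p.
  case=> // -[[x|x] -> h] // _; exists (inr x) => //; exact: clos_refl.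
have inv2 w : inv (place 2 3 w) -> G (place 0 3 u) (place 2 3 w).
  case; last by case.
  move=> [z uz]; case: w => x /=; last first.
    set p := (3, x); have : p.1 = 3 by [].
    move=> p3 h; exfalso; move: h p3; case.
      by case: z {uz}.
    by move=> ? ? _ [] [[y|y] [[t|t] [_ -> _]]].
  rewrite -[(2, x)]/(place 0 2 (inr x)).
  move=> /(@same_block_mul_glue 0 1 2 _ _ _ _ isT isT isT) zx.
  apply: clos_step uz _; left.
  exact: glue_step_place.
have inv0 w : inv (place 0 2 w) -> G (place 0 3 u) (place 0 2 w).
  move=> /inv1[|z uz]; first by case: w.
  move=> /(@same_block_mul_glue 0 1 2 _ _ _ _ isT isT isT) zw.
  by apply: clos_step uz _; left; exact: glue_step_place.
suff H p : glue3 a b c (place 0 3 u) p -> inv p.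
  move=> /H; case: v => x; first exact: (inv0 (inl x)).
  exact: (inv2 (inr x)).
elim=> [|q r _ iq].
  rewrite /inv; case: (u) => x; [left; exists (inl x)|right; exists (inr x)];
    by [|exact: clos_refl].
case=> -[x [y [qE rE xy]]]; move: iq; rewrite {}qE {}rE.
- move=> /inv1[|z uz zx]; first by case: x {xy}.
  left; exists z => //; apply: clos_step zx _; left; exact: glue_step_place.
- move=> /inv1[|z uz zx]; first by case: x {xy}.
  left; exists z => //; apply: clos_step zx _; right; exact: glue_step_place.
- move=> /inv2 ux; right; exists y => //; apply: clos_step ux _; right.
  exact: glue_step_place.
Qed.

Let mulCS_right a b c u v : same_block (mulCS a (mulCS b c)) u v <->
  glue3 a b c (place 0 3 u) (place 0 3 v).
Proof.
rewrite (@same_block_mul_glue 0 1 3) //; split.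
  apply: (clos_map (f := id)) => p q [h|[x [y [-> -> xy]]]].
    by apply: clos1; constructor 1.
  move/(@same_block_mul_glue 1 2 3 _ _ _ _ isT isT isT): xy.
  apply: (clos_map (f := id)) => r s [h|h]; apply: clos1.
    by constructor 2.
  by constructor 3.
set G := glue2 0 1 3 _ _.
pose inv p := (exists2 w, G (place 0 3 u) (place 1 3 w) &
                 glue2 1 2 3 b c (place 1 3 w) p) \/
   (exists2 w, p = place 0 1 w & G (place 0 3 u) p).
have inv1 p : inv p -> 0 < p.1 -> exists2 w, G (place 0 3 u) (place 1 3 w) &
                 glue2 1 2 3 b c (place 1 3 w) p.
  case=> // -[[x|x] -> h] // _; exists (inl x) => //; exact: clos_refl.
have inv2 w : inv (place 0 1 w) -> G (place 0 3 u) (place 0 1 w).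
  case; last by case.
  move=> [z uz]; case: w => x /=.
    set p := (0, x); have : p.1 = 0 by [].
    move=> p3 h; exfalso; move: h p3; case.
      by case: z {uz}.
    by move=> ? ? _ [] [[y|y] [[t|t] [_ -> _]]].
  rewrite -[(1, x)]/(place 1 3 (inl x)).
  move=> /(@same_block_mul_glue 1 2 3 _ _ _ _ isT isT isT) zx.
  apply: clos_step uz _; right.
  exact: glue_step_place.
have inv0 w : inv (place 1 3 w) -> G (place 0 3 u) (place 1 3 w).
  move=> /inv1[|z uz]; first by case: w.
  move=> /(@same_block_mul_glue 1 2 3 _ _ _ _ isT isT isT) zw.
  by apply: clos_step uz _; right; exact: glue_step_place.
suff H p : glue3 a b c (place 0 3 u) p -> inv p.
  move=> /H; case: v => x; first exact: (inv2 (inl x)).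
  exact: (inv0 (inr x)).
elim=> [|q r _ iq].
  rewrite /inv; case: (u) => x; [right; exists (inl x)|left; exists (inr x)];
    by [|exact: clos_refl].
case=> -[x [y [qE rE xy]]]; move: iq; rewrite {}qE {}rE.
- move=> /inv2 ux; right; exists y => //; apply: clos_step ux _; left.
  exact: glue_step_place.
- move=> /inv1[|z uz zx]; first by case: x {xy}.
  left; exists z => //; apply: clos_step zx _; left; exact: glue_step_place.
- move=> /inv1[|z uz zx]; first by case: x {xy}.
  left; exists z => //; apply: clos_step zx _; right; exact: glue_step_place.
Qed.

Lemma mulCSA : associative mulCS.
Proof. by move=> a b c; apply: CS_ext => u v; rewrite mulCS_left mulCS_right. Qed.

End gluing.

HB.instance Definition _ (X : Type) := isSemigroup.Build (CS X) (@mulCSA X).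

Local Open Scope group_scope.

Definition meets_both (X : Type) : pred (CS X) := fun a =>
  `[< forall B, blocks a B ->
        B `&` range inl !=set0 /\ B `&` range inr !=set0 >].

Record IP (X : Type) : Type := MkIP {
  IPval :> CS X;
  IPvalP : meets_both IPval
}.

HB.instance Definition _ (X : Type) := [isSub of IP X for @IPval X].
HB.instance Definition _ (X : Type) := [Choice of IP X by <:].

Lemma meets_bothP (X : Type) (a : CS X) : meets_both a <->
  (forall x, exists y, same_block a (inl x) (inr y)) /\
  (forall y, exists x, same_block a (inl x) (inr y)).
Proof.
split.
  move=> /asboolP h; split=> x.
    have [B aB [Bx _]] := same_block_refl a (inl x).
    by have [_ [z [Bz [y _ E]]]] := h B aB; exists y; exists B; rewrite ?E.
  have [B aB [Bx _]] := same_block_refl a (inr x).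
  by have [[z [Bz [y _ E]]] _] := h B aB; exists y; exists B; rewrite ?E.
move=> [hl hr]; apply/asboolP => B; rewrite blocksE => -[[x|x] _ <-].
  have [y xy] := hl x.
  by split; [exists (inl x)|exists (inr y)]; split=> //=;
    [exact: same_block_refl|exists x|exists y].
have [y xy] := hr x; by split; [exists (inl y)|exists (inr x)]; split=> //=;
  [exact: same_block_sym|exists y|exact: same_block_refl|exists x].
Qed.

Lemma meets_both_mul (X : Type) : mulg_closed (@meets_both X).
Proof.
move=> a b aI bI.
have [al ar] := (meets_bothP a).1 aI; have [bl br] := (meets_bothP b).1 bI.
have cross x c y : same_block a (inl x) (inr c) -> same_block b (inl c) (inr y) ->
    same_block (a * b) (inl x) (inr y).
  move=> xc cy; apply/same_block_mul; exists 1%N, (fun=> c); split=> //= i; lia.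
apply: (meets_bothP (a * b)).2; split=> x.
  have [c xc] := al x; have [y cy] := bl c; exists y; exact: cross cy.
have [c cx] := br x; have [y yc] := ar c; exists y; exact: cross cx.
Qed.

HB.instance Definition _ (X : Type) :=
  SubChoice_isSubSemigroup.Build (CS X) (@meets_both X) (IP X) (@meets_both_mul X).

Record Sym (X : Type) : Type := MkSym {
  sym_fun :> X -> X;
  sym_bij : bijective sym_fun
}.

HB.instance Definition _ (X : Type) := gen_eqMixin (Sym X).
HB.instance Definition _ (X : Type) := gen_choiceMixin (Sym X).

Section symmetric_group.
Variable X : Type.
Implicit Types g h : Sym X.

Lemma sym_eq g h : g =1 h -> g = h.
Proof.
case: g h => [f fb] [k kb] /= /funext E; subst k.
by congr MkSym; exact: Prop_irrelevance.
Qed.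

Definition sym_one : Sym X := MkSym (@Bijective X X id id (fun=> erefl) (fun=> erefl)).

(* Left-to-right product: (g h)(x) = h (g x). *)
Definition sym_mul g h : Sym X := MkSym (bij_comp (sym_bij h) (sym_bij g)).

Lemma sym_inv_subproof g : {h : X -> X | cancel g h /\ cancel h g}.
Proof. by apply: cid; have [h gh hg] := sym_bij g; exists h. Qed.

Definition sym_inv g : Sym X :=
  let: exist h (conj gh hg) := sym_inv_subproof g in MkSym (Bijective hg gh).

Lemma sym_invK g : cancel g (sym_inv g).
Proof. by rewrite /sym_inv; case: sym_inv_subproof => h []. Qed.

Lemma sym_invVK g : cancel (sym_inv g) g.
Proof. by rewrite /sym_inv; case: sym_inv_subproof => h []. Qed.

Lemma sym_mulA : associative sym_mul.
Proof. by move=> f g h; exact: sym_eq. Qed.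

Lemma sym_mul1g : left_id sym_one sym_mul.
Proof. by move=> g; exact: sym_eq. Qed.

Lemma sym_mulg1 : right_id sym_one sym_mul.
Proof. by move=> g; exact: sym_eq. Qed.

Lemma sym_mulVg : left_inverse sym_one sym_inv sym_mul.
Proof. by move=> g; apply: sym_eq => x /=; rewrite sym_invVK. Qed.

Lemma sym_mulgV : right_inverse sym_one sym_inv sym_mul.
Proof. by move=> g; apply: sym_eq => x /=; rewrite sym_invK. Qed.

HB.instance Definition _ :=
  isGroup.Build (Sym X) sym_mulA sym_mul1g sym_mulg1 sym_mulVg sym_mulgV.

Definition perm_blocks g : set (set (X + X)) :=
  [set [set inl x; inr (g x)] | x in [set: X]].

Lemma perm_blocksP g : partition (perm_blocks g) id [set: X + X].
Proof.
split.
- apply/seteqP; split=> // -[x|x] _.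
    by exists [set inl x; inr (g x)]; [exists x|left].
  have [h gh hg] := sym_bij g.
  by exists [set inl (h x); inr (g (h x))]; [exists (h x)|right; rewrite hg].
- move=> _ _ [x _ <-] [y _ <-] [_ [] /= [->|->] []] //; first by case=> ->.
  by case=> /(bij_inj (sym_bij g)) ->.
- by move=> _ [x _ <-]; exists (inl x); left.
Qed.

Lemma perm_blocks_meets g : meets_both (MkCS (perm_blocksP g)).
Proof.
apply/asboolP => _ [x _ <-].
by split; [exists (inl x); split; [left|exists x]
          |exists (inr (g x)); split; [right|exists (g x)]].
Qed.

Definition perm_IP g : IP X := MkIP (perm_blocks_meets g).

End symmetric_group.

Definition is_morph (S : magmaType) : pred (Sym S) :=
  fun f => `[< {morph f : x y / x * y} >].

(* The group operations are those of Sym S, so automorphisms compose from     *)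
(* left to right as well.                                                     *)
Record Aut (S : magmaType) : Type := MkAut {
  Autval :> Sym S;
  AutvalP : is_morph Autval
}.

HB.instance Definition _ (S : magmaType) := [isSub of Aut S for @Autval S].
HB.instance Definition _ (S : magmaType) := [Choice of Aut S by <:].

Lemma is_morph_closed (S : magmaType) : group_closed (@is_morph S).
Proof.
split; first exact/asboolP.
move=> f g /asboolP fM /asboolP gM; apply/asboolP => x y /=.
rewrite fM; apply: (bij_inj (sym_bij g)).
by rewrite gM !sym_invVK.
Qed.

HB.instance Definition _ (S : magmaType) :=
  SubChoice_isSubGroup.Build (Sym S) (@is_morph S) (Aut S) (@is_morph_closed S).

Definition group_isomorphic (G H : groupType) : Prop :=
  exists f : {multiplicative G -> H}, bijective f.

(* Main.v *)
Require Import Defs.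
From HB Require Import structures.
From mathcomp Require Import all_boot all_classical.
From mathcomp Require Import zify.

Set Implicit Arguments.
Unset Strict Implicit.
Unset Printing Implicit Defensive.

Local Open Scope classical_set_scope.
Local Open Scope card_scope.
Local Open Scope group_scope.

(* An element of IP_X is determined by the difunctional relation it induces  *)
(* between X and X', and the product is the least difunctional relation      *)
(* containing the composition. Idempotents are the equivalences E on X, with *)
(* E <= F iff E F = F, so an automorphism acts on the lattice of             *)
(* equivalences. If |X| >= 3, that action comes from a permutation g: it     *)
(* permutes the atoms, i.e. the pairs of points; a triangle xy, xz, yz is    *)
(* recognised by each of its sides lying below the join of the other two, so *)
(* triangles go to triangles, and the images of the pairs containing x share *)
(* a point g x. Composing with conjugation by g^-1 gives an automorphism psi *)
(* that fixes idempotents. It preserves the kernels of a on X and on X', and *)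
(* merging two blocks of a shows that psi a can only match a block of X with *)
(* a different block of X' when a has exactly 2 blocks. Then psi a is a or   *)
(* the other bijection a*; one of the two coarsens an element of rank 3, so  *)
(* it is fixed, and by injectivity both are.                                 *)

(** Two rigidity facts carry the proof. On a set with at least three points, every automorphism of
    the lattice of equivalences comes from a permutation ([eqv_iso_perm]), because pairs sharing a
    point are sent to pairs sharing a point. On such a set, an injective endomorphism of IP_X fixing
    all idempotents is the identity ([idempotent_fixing_id]). The link is [idempotent_idem], which
    reads idempotents as equivalences, and [idem_mulP] and [mul_idemP], which express the two
    kernels of an element by products. [Aut_inner_ge3] combines the two facts.

    If |X| = 2, the only elements are the identity, the transposition and the one-block element, and
    the product tells them apart ([Aut_id_eq2]). With fewer points there is one element. Choosing a
    permutation for each automorphism gives the isomorphism, since for |X| different from 2 distinct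
    permutations conjugate differently ([conj_inj]). *)

Section cross.
Variable X : Type.
Implicit Types (a b : IP X) (R : X -> X -> Prop).

Definition cross a x y := same_block a (inl x) (inr y).

Definition difunctional R :=
  forall x y z w, R x y -> R z y -> R z w -> R x w.

Lemma cross_difun a : difunctional (cross a).
Proof.
move=> x y z w xy zy zw; apply: same_block_trans xy _.
by apply: same_block_trans zw; exact: same_block_sym.
Qed.

Lemma cross_total a x : exists y, cross a x y.
Proof. by have [+ _] := (meets_bothP a).1 (IPvalP a); apply. Qed.

Lemma cross_surj a y : exists x, cross a x y.
Proof. by have [_ +] := (meets_bothP a).1 (IPvalP a); apply. Qed.

Lemma same_block_crossP a u v : same_block a u v <->
  match u, v with
  | inl x, inl y => exists2 z, cross a x z & cross a y z
  | inr x, inr y => exists2 z, cross a z x & cross a z y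
  | inl x, inr y | inr y, inl x => cross a x y
  end.
Proof.
case: u v => x [] y //; split=> //.
- have [z yz] := cross_total a y => xy; exists z => //.
  exact: same_block_trans xy yz.
- by move=> [z xz yz]; apply: same_block_trans xz _; exact: same_block_sym.
- exact: same_block_sym.
- exact: same_block_sym.
- have [z zx] := cross_surj a x => xy; exists z => //.
  exact: same_block_trans zx xy.
- move=> [z zx zy]; apply: same_block_trans zy; exact: same_block_sym.
Qed.

Lemma IP_ext a b : (forall x y, cross a x y <-> cross b x y) -> a = b.
Proof.
move=> ab; apply: val_inj; apply: CS_ext => u v.
rewrite !same_block_crossP; case: u v => x [] y; rewrite ?ab//.
  by split=> -[z xz yz]; exists z; apply/ab.
by split=> -[z xz yz]; exists z; apply/ab.
Qed.

(** Blocks are the fibres of a labelling: a point of X is labelled by its image under [R], a point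
    of X' by the points sharing a preimage with it. Difunctionality makes the labels of related
    points agree. *)
Lemma rel_IP R : (forall x, exists y, R x y) -> (forall y, exists x, R x y) ->
  difunctional R -> {a : IP X | forall x y, cross a x y <-> R x y}.
Proof.
move=> Rt Rs Rd; apply: cid.
pose f (u : X + X) : set X := match u with
  | inl x => [set y | R x y]
  | inr y => [set y' | exists2 x, R x y & R x y']
  end.
have P : partition [set [set v | f u = f v] | u in [set: X + X]] id setT.
  by apply: partition_classes => [//|u v ->//|v u w -> ->].
pose a := MkCS P.
have aE u v : same_block a u v <-> f u = f v.
  split=> [[_ [w _ <-] [/= <- <-]]//|uv].
  by exists [set w | f u = f w]; [exists u|].
have fR x y : f (inl x) = f (inr y) <-> R x y.
  split=> [fxy|xy].
    have : f (inr y) y by have [z zy] := Rs y; exists z.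
    by rewrite -fxy.
  apply/seteqP; split=> z /= => [xz|[w wy wz]]; first by exists x.
  exact: Rd xy wy wz.
have aI : meets_both a.
  apply: (meets_bothP a).2; split=> x.
    by have [y xy] := Rt x; exists y; rewrite aE fR.
  by have [y xy] := Rs x; exists y; rewrite aE fR.
by exists (MkIP aI) => x y; rewrite /cross /= aE fR.
Qed.

Lemma cross_comp a b x c y : cross a x c -> cross b c y -> cross (a * b) x y.
Proof.
move=> xc cy; apply/same_block_mul; exists 1%N, (fun=> c).
by split=> //= i; lia.
Qed.

Lemma cross_mul_least a b R : difunctional R ->
  (forall x c y, cross a x c -> cross b c y -> R x y) ->
  forall x y, cross (a * b) x y -> R x y.
Proof.
move=> Rd abR x y /same_block_mul[s [c [s1 xc hb ha cy]]].
suff H i : (i < s)%N -> forall w, cross b (c (2 * i + 1)%N) w -> R x w.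
  apply: (H s.-1); first lia.
  by have -> : (2 * s.-1 + 1 = 2 * s - 1)%N by lia.
elim: i => [_ w|i IH si w iw]; first exact: abR.
have si' : (0 < i.+1 < s)%N by lia.
(* Difunctionality shortens the chain by one link: [R] relates [x] to [v], and some [z] to both [v]
   and [w]. *)
have [v vb] := cross_total b (c (2 * i.+1)%N).
have xv : R x v.
  apply: IH; first lia.
  have := hb _ si'; have -> : (2 * i.+1 - 1 = 2 * i + 1)%N by lia.
  by move=> h; exact: same_block_trans h vb.
have [z zc] := cross_surj a (c (2 * i.+1)%N).
have zc' : cross a z (c (2 * i.+1 + 1)%N) by exact: same_block_trans (ha _ si').
exact: Rd xv (abR _ _ _ zc vb) (abR _ _ _ zc' iw).
Qed.

End cross.

(** * Equivalences on X and the atoms of their lattice *)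

Record eqv (X : Type) := MkEqv {
  eqv_rel :> X -> X -> Prop;
  eqv_refl x : eqv_rel x x;
  eqv_sym x y : eqv_rel x y -> eqv_rel y x;
  eqv_trans y x z : eqv_rel x y -> eqv_rel y z -> eqv_rel x z
}.

Arguments eqv_refl {X e x}.
Arguments eqv_sym {X e x y}.
Arguments eqv_trans {X e y x z}.

Definition sub_eqv X (E F : eqv X) := forall x y, E x y -> F x y.

Section eqv_constructions.
Variable X : Type.

Lemma kernel_subproof (T : Type) (k : X -> T) y x z :
  k x = k y -> k y = k z -> k x = k z.
Proof. by move=> -> ->. Qed.

Definition kernel (T : Type) (k : X -> T) : eqv X :=
  @MkEqv X (fun x y => k x = k y) (fun=> erefl) (fun _ _ e => esym e)
    (kernel_subproof (k := k)).

Lemma collapse_subproof (A : X -> Prop) y x z :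
  x = y \/ A x /\ A y -> y = z \/ A y /\ A z -> x = z \/ A x /\ A z.
Proof. by move=> [->//|[Ax Ay]] [<-|[_ Az]]; right. Qed.

Lemma collapse_sym_subproof (A : X -> Prop) x y :
  x = y \/ A x /\ A y -> y = x \/ A y /\ A x.
Proof. by move=> [->|[]]; [left|right]. Qed.

Definition collapse (A : X -> Prop) : eqv X :=
  @MkEqv X (fun x y => x = y \/ A x /\ A y) (fun=> or_introl erefl)
    (@collapse_sym_subproof A) (@collapse_subproof A).

Definition pair_eqv (x y : X) := collapse (fun z => z = x \/ z = y).

Lemma sub_pair_eqv x y (E : eqv X) : sub_eqv (pair_eqv x y) E <-> E x y.
Proof.
split=> [|xy u v]; first by apply; right; split; [left|right].
case=> [->|[[->|->] [->|->]]]//; by [exact: eqv_refl|exact: eqv_sym].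
Qed.

End eqv_constructions.

(** * Automorphisms of the lattice of equivalences *)

(** Adjointness on both sides makes the maps mutually inverse order isomorphisms, without any
    equality between equivalences. *)
Definition eqv_iso X (Phi Psi : eqv X -> eqv X) :=
  (forall E F, sub_eqv (Phi E) F <-> sub_eqv E (Psi F)) /\
  (forall E F, sub_eqv (Psi E) F <-> sub_eqv E (Phi F)).

Section partition_lattice_automorphism.
Variable X : Type.
Implicit Types (Phi Psi : eqv X -> eqv X) (E F : eqv X) (x y z a b c d : X).

Lemma eqv_iso_sym Phi Psi : eqv_iso Phi Psi -> eqv_iso Psi Phi.
Proof. by case. Qed.

Lemma eqv_iso_adj Phi Psi E F : eqv_iso Phi Psi ->
  sub_eqv (Phi E) F <-> sub_eqv E (Psi F).
Proof. by case. Qed.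

Lemma eqv_iso_sub_pair Phi Psi x y F : eqv_iso Phi Psi ->
  sub_eqv (Phi (pair_eqv x y)) F <-> Psi F x y.
Proof. by move=> iso; rewrite (eqv_iso_adj _ _ iso); exact: sub_pair_eqv. Qed.

Lemma eqv_isoK Phi Psi : eqv_iso Phi Psi ->
  forall E x y, Psi (Phi E) x y <-> E x y.
Proof.
move=> [adj adj'] E x y.
have h : sub_eqv (Psi (Phi E)) E by apply/adj'.
have h' : sub_eqv E (Psi (Phi E)) by apply/adj.
by split=> [/h|/h'].
Qed.

Lemma eqv_iso_mono Phi Psi E F : eqv_iso Phi Psi ->
  sub_eqv E F -> sub_eqv (Phi E) (Phi F).
Proof.
move=> iso EF; apply: (iso.1 _ _).2 => x y /EF ?.
exact: (eqv_isoK iso _ _ _).2.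
Qed.

Lemma eqv_iso_nontrivial Phi Psi x y : eqv_iso Phi Psi -> x <> y ->
  exists a b, a <> b /\ Phi (pair_eqv x y) a b.
Proof.
move=> iso xy; apply: contrapT => H; apply: xy.
have : sub_eqv (Phi (pair_eqv x y)) (Phi (kernel id)).
  move=> a b ab; have [<-|nab] := pselect (a = b); first exact: eqv_refl.
  by exfalso; apply: H; exists a, b.
by move=> /(eqv_iso_sub_pair _ _ _ iso)/(eqv_isoK iso).
Qed.

(** Atoms go to atoms: for a pair [a], [b] below the image, the preimage of its atom is nontrivial
    and below the atom of [x], [y], hence equal to it. *)
Lemma eqv_iso_pair Phi Psi x y : eqv_iso Phi Psi -> x <> y ->
  exists a b, a <> b /\ forall u v, Phi (pair_eqv x y) u v <-> pair_eqv a b u v.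
Proof.
move=> iso xy; have [a [b [nab ab]]] := eqv_iso_nontrivial iso xy.
exists a, b; split=> // u v; split; last first.
  by apply: (sub_pair_eqv _ _ _).2.
have ab_xy : sub_eqv (Psi (pair_eqv a b)) (pair_eqv x y).
  by apply: (eqv_iso_sub_pair _ _ _ (eqv_iso_sym iso)).2.
have [c [d [ncd cd]]] := eqv_iso_nontrivial (eqv_iso_sym iso) nab.
suff : sub_eqv (Phi (pair_eqv x y)) (pair_eqv a b) by apply.
apply: (eqv_iso_sub_pair _ _ _ iso).2.
have := ab_xy _ _ cd.
by case=> [//|[[cE|cE] [dE|dE]]]; subst c d => //; exact: eqv_sym.
Qed.

End partition_lattice_automorphism.

(** * The point map behind a lattice automorphism *)

Section induced_by_permutation.
Variables (X : Type) (Phi Psi : eqv X -> eqv X).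
Hypothesis iso : eqv_iso Phi Psi.

(** Pairs are viewed as edges; for distinct [x], [y] this is the set of endpoints of the image
    edge. *)
Let M x y a := exists2 b, b <> a & Phi (pair_eqv x y) a b.

Let MP x y : x <> y -> exists a b, [/\ a <> b,
  forall u v, Phi (pair_eqv x y) u v <-> pair_eqv a b u v &
  forall u, M x y u <-> u = a \/ u = b].
Proof.
move=> xy; have [a [b [ab P]]] := eqv_iso_pair iso xy.
exists a, b; split=> // u; split=> [[v vu /P[/esym//|[]//]]|].
case=> ->.
  by exists b; [exact: nesym|apply/P; right; split; [left|right]].
by exists a => //; apply/P; right; split; [right|left].
Qed.

Let MC x y a : M x y a -> M y x a.
Proof.
move=> [b ba ab]; exists b => //; apply: eqv_iso_mono iso _ _ _ ab.
by apply/sub_pair_eqv; right; split; [right|left].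
Qed.

Let M_ex2 x y a : x <> y -> M x y a -> exists2 b, b <> a & M x y b.
Proof.
move=> /MP[c [d [cd _ Mcd]]] /Mcd[->|->].
  by exists d; [exact: nesym|apply/Mcd; right].
by exists c => //; apply/Mcd; left.
Qed.

Let M_le2 x y a b c : x <> y -> M x y a -> M x y b -> M x y c ->
  [\/ a = b, a = c | b = c].
Proof.
move=> /MP[d [e [_ _ Mde]]] /Mde[]-> /Mde[]-> /Mde[]->;
  by [constructor 1|constructor 2|constructor 3].
Qed.

Let M_rel x y a b : x <> y -> M x y a -> M x y b -> Phi (pair_eqv x y) a b.
Proof.
move=> /MP[d [e [_ P Mde]]] /Mde ad /Mde be; apply/P; right; by split.
Qed.

Let M_eqvP x y a b : x <> y -> a <> b -> M x y a -> M x y b ->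
  forall u v, Phi (pair_eqv x y) u v <-> pair_eqv a b u v.
Proof.
move=> xy ab xa xb u v; split; last first.
  by apply: (sub_pair_eqv _ _ _).2; exact: M_rel.
have [c [d [_ P Mcd]]] := MP xy.
move=> /P; apply: (sub_pair_eqv _ _ _).2.
move: ab; have [/Mcd[]-> /Mcd[]-> //] := (xa, xb) => _.
  by right; split; [left|right].
by right; split; [right|left].
Qed.

Let M_inj x y z w a b : x <> y -> z <> w -> a <> b ->
  M x y a -> M x y b -> M z w a -> M z w b -> pair_eqv x y z w.
Proof.
move=> xy zw ab xa xb za zb; apply/(eqv_isoK iso).
have : sub_eqv (Phi (pair_eqv z w)) (Phi (pair_eqv x y)).
  by move=> u v /(M_eqvP zw ab za zb)/(M_eqvP xy ab xa xb).
by move=> /(eqv_iso_sub_pair _ _ _ iso).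
Qed.

Let M_inj3 x y z a b : x <> y -> x <> z -> y <> z -> a <> b ->
  M x y a -> M x y b -> M x z a -> M x z b -> False.
Proof.
move=> xy xz yz ab h1 h2 h3 h4.
have [//|[_ [/esym//|/esym//]]] := M_inj xy xz ab h1 h2 h3 h4.
Qed.

(** The triangle condition: transitivity of [Psi F] puts one side below the join of the other
    two. *)
Let M_join x y z F : sub_eqv (Phi (pair_eqv x y)) F ->
  sub_eqv (Phi (pair_eqv x z)) F -> sub_eqv (Phi (pair_eqv y z)) F.
Proof.
move=> /(eqv_iso_sub_pair _ _ _ iso) xy /(eqv_iso_sub_pair _ _ _ iso) xz.
by apply: (eqv_iso_sub_pair _ _ _ iso).2; apply: eqv_trans xz; exact: eqv_sym.
Qed.

(** Otherwise the images form a star at [a], and collapsing two of its edges leaves the third end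
    separate, against [M_join]. *)
Let M_nostar x y z a : x <> y -> x <> z -> y <> z ->
  M x y a -> M x z a -> M y z a -> False.
Proof.
move=> xy xz yz xya xza yza.
have [b ba xyb] := M_ex2 xy xya.
have [c ca xzc] := M_ex2 xz xza.
have [d da yzd] := M_ex2 yz yza.
have bc : b <> c by move=> E; subst c; exact: (M_inj3 xy xz yz ba).
have bd : b <> d.
  move=> E; subst d; apply: (@M_inj3 y x z b a) => //;
    by [exact: nesym|exact: MC].
have cd : c <> d.
  move=> E; subst d; apply: (@M_inj3 z x y c a) => //;
    by [exact: nesym|exact: MC].
have F1 : sub_eqv (Phi (pair_eqv y z))
    (collapse (fun t => t = a \/ t = b \/ t = c)).
  apply: (@M_join x) => u v.
    move=> /(M_eqvP xy ba xyb xya)[->|[]]; first by left.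
    by case=> -> [] ->; right; split; tauto.
  move=> /(M_eqvP xz ca xzc xza)[->|[]]; first by left.
  by case=> -> [] ->; right; split; tauto.
have [/esym//|[_ [//|[/esym//|/esym//]]]] := F1 _ _ (M_rel yz yza yzd).
Qed.

(** If the two image edges were disjoint, their join would contain no other edge, so the third side
    would share its image with one of the first two. *)
Let M_meet x y z : x <> y -> x <> z -> y <> z -> exists2 a, M x y a & M x z a.
Proof.
move=> xy xz yz; apply: contrapT => H.
have [a [b [ab P Mab]]] := MP xy; have [c [d [cd Q Mcd]]] := MP xz.
have [e [f [ef _ Mef]]] := MP yz.
have xya : M x y a by apply/Mab; left.
have xyb : M x y b by apply/Mab; right.
have xzc : M x z c by apply/Mcd; left.
have xzd : M x z d by apply/Mcd; right.
have yze : M y z e by apply/Mef; left.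
have yzf : M y z f by apply/Mef; right.
have ac : a <> c by move=> E; apply: H; exists a => //; rewrite E.
have ad : a <> d by move=> E; apply: H; exists a => //; rewrite E.
have bc : b <> c by move=> E; apply: H; exists b => //; rewrite E.
have bd : b <> d by move=> E; apply: H; exists b => //; rewrite E.
have nxy u v : u <> v -> M x y u -> M x y v -> M y z u -> M y z v -> False.
  by move=> uv *; apply: (@M_inj3 y x z u v) => //; by [exact: nesym|exact: MC].
have nxz u v : u <> v -> M x z u -> M x z v -> M y z u -> M y z v -> False.
  by move=> uv *; apply: (@M_inj3 z x y u v) => //; by [exact: nesym|exact: MC].
(* The nontrivial blocks of the kernel of k are {a, b} and {c, d}. *)
pose k t := if pselect (t = a) then b else if pselect (t = c) then d else t.
have kab : k a = k b by rewrite /k; repeat case: pselect => //=; congruence.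
have kcd : k c = k d by rewrite /k; repeat case: pselect => //=; congruence.
have kef : k e = k f.
  have : sub_eqv (Phi (pair_eqv y z)) (kernel k).
    apply: (@M_join x) => u v.
      by move=> /P; apply: (sub_pair_eqv _ _ (kernel k)).2.
    by move=> /Q; apply: (sub_pair_eqv _ _ (kernel k)).2.
  by apply; apply: M_rel.
move: kef; rewrite /k.
case: (pselect (e = a)) => [?|ea]; case: (pselect (f = a)) => [?|fa];
  try (subst; congruence).
- case: (pselect (f = c)) => [?|fc] /= ?; first by subst.
  by subst f e; exact: (nxy a b).
- case: (pselect (e = c)) => [?|ec] /= ?; first by subst.
  by subst f e; exact: (nxy a b).
- case: (pselect (e = c)) => [?|ec]; case: (pselect (f = c)) => [?|fc] /= ?;
    try (subst; congruence).
  + by subst; exact: (nxz c f).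
  + by subst; exact: (nxz c d).
Qed.

Lemma eqv_iso_points :
  (exists x y z : X, [/\ x <> y, x <> z & y <> z]) ->
  exists2 g : X -> X, injective g &
    forall (E : eqv X) x y, E x y -> Phi E (g x) (g y).
Proof.
move=> [p [q [r [pq pr qr]]]].
have third (x y : X) : exists2 z, z <> x & z <> y.
  apply: contrapT => H.
  have [Ep Eq Er] : [/\ p = x \/ p = y, q = x \/ q = y & r = x \/ r = y].
    by split; apply: contrapT => /not_orP[? ?]; apply: H;
      [exists p|exists q|exists r].
  by case: Ep => ?; case: Eq => ?; case: Er => ?; congruence.
have ex x : exists a, forall y, x <> y -> M x y a.
  have [y yx _] := third x x; have [z zx zy] := third x y.
  have [xy xz yz] : [/\ x <> y, x <> z & y <> z] by split; exact: nesym.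
  have [a xya xza] := M_meet xy xz yz; exists a => w xw.
  have [->//|wy] := pselect (w = y); have [->//|wz] := pselect (w = z).
  apply: contrapT => xwa.
  (* An image of [xw] missing [a] meets those of [xy] and [xz] at their other ends [d] and [e]. The
     image of [yz] has these ends too, so [xw] and [yz] would be the same edge. *)
  have [d xwd xyd] := M_meet xw xy wy.
  have [e xwe xze] := M_meet xw xz wz.
  have da : d <> a by move=> E; subst d.
  have ea : e <> a by move=> E; subst e.
  have de : d <> e by move=> E; subst e; exact: (M_inj3 xy xz yz da).
  have [d' yzd' yxd'] := M_meet yz (nesym xy) (nesym xz).
  have [e' zye' zxe'] := M_meet (nesym yz) (nesym xz) (nesym xy).
  have d'a : d' <> a by move=> E; subst d'; exact: (M_nostar xy xz yz xya).
  have e'a : e' <> a.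
    by move=> E; subst e'; apply: (M_nostar xy xz yz xya xza); exact: MC.
  have d'E : d' = d.
    by have [/esym//|/esym//|/esym//] := M_le2 xy xyd xya (MC yxd').
  have e'E : e' = e.
    by have [/esym//|/esym//|/esym//] := M_le2 xz xze xza (MC zxe').
  subst d' e'.
  have := M_inj xw yz de xwd xwe yzd' (MC zye').
  by case=> [//|[[?|?] [?|?]]]; congruence.
have [g gM] := choice ex.
have g_inj : injective g.
  move=> x y gxy; apply: contrapT => xy; have [z zx zy] := third x y.
  have [xz yz] : x <> z /\ y <> z by split; exact: nesym.
  apply: (M_nostar xy xz yz (gM _ _ xy) (gM _ _ xz)).
  by rewrite gxy; exact: gM.
exists g => // E x y Exy.
have [->|xy] := pselect (x = y); first exact: eqv_refl.
apply: (eqv_iso_mono iso ((sub_pair_eqv _ _ _).2 Exy)).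
by apply: M_rel => //; [exact: gM|exact: MC (gM _ _ (nesym xy))].
Qed.

End induced_by_permutation.

(** A moved point [x] forces every other point to equal [k x], leaving only two points. *)
Lemma pair_eqv_fixed (X : Type) (k : X -> X) :
  (exists x y z : X, [/\ x <> y, x <> z & y <> z]) -> injective k ->
  (forall x y, pair_eqv x y (k x) (k y)) -> forall x, k x = x.
Proof.
move=> [p [q [r [pq pr qr]]]] ki kP x; apply: contrapT => kx.
have E y : x <> y -> y = k x by move=> xy; case: (kP x y) => [/ki//|[[]]].
have [?|xp] := pselect (x = p).
  by subst p; apply: qr; rewrite (E q) // (E r).
have [?|xq] := pselect (x = q).
  by subst q; apply: pr; rewrite (E p) // (E r).
by apply: pq; rewrite (E p) // (E q).
Qed.

Lemma eqv_iso_perm (X : Type) (Phi Psi : eqv X -> eqv X) :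
  (exists x y z : X, [/\ x <> y, x <> z & y <> z]) -> eqv_iso Phi Psi ->
  exists g : Sym X, forall (E : eqv X) x y, Phi E (g x) (g y) <-> E x y.
Proof.
move=> X3 iso.
have inverse (F G : eqv X -> eqv X) (f k : X -> X) : eqv_iso F G ->
    injective f -> injective k ->
    (forall (E : eqv X) x y, E x y -> F E (f x) (f y)) ->
    (forall (E : eqv X) x y, E x y -> G E (k x) (k y)) -> cancel f k.
  move=> FG fi ki Ff Gk x.
  apply: (pair_eqv_fixed X3 (k := k \o f)) => [u v /ki/fi//|u v].
  apply: (eqv_isoK FG _ _ _).1; apply/Gk/Ff.
  by right; split; [left|right].
have [g gi gP] := eqv_iso_points iso X3.
have [h hi hP] := eqv_iso_points (eqv_iso_sym iso) X3.
have gh : cancel g h by exact: inverse iso gi hi gP hP.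
have hg : cancel h g by exact: inverse (eqv_iso_sym iso) hi gi hP gP.
exists (MkSym (Bijective gh hg)) => E x y /=; split=> [/hP|/gP//].
by rewrite !gh => /(eqv_isoK iso).
Qed.

(** * Idempotents as equivalences, and the kernels of an element *)

Section idempotents.
Variable X : Type.
Implicit Types (a b : IP X) (E F : eqv X).

Lemma eqv_difun E : difunctional E.
Proof.
by move=> x y z w xy /eqv_sym yz zw; exact: eqv_trans xy (eqv_trans yz zw).
Qed.

Definition idem E : IP X :=
  sval (rel_IP (fun x => ex_intro (E x) x (@eqv_refl _ E x))
    (fun x => ex_intro (E^~ x) x (@eqv_refl _ E x)) (@eqv_difun E)).

Lemma cross_idem E x y : cross (idem E) x y <-> E x y.
Proof. by rewrite /idem; case: rel_IP. Qed.

Definition dom a : eqv X := @MkEqv X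
  (fun x y => same_block a (inl x) (inl y))
  (fun=> same_block_refl _ _)
  (fun _ _ => @same_block_sym _ _ _ _)
  (fun _ _ _ => @same_block_trans _ _ _ _ _).

Definition cod a : eqv X := @MkEqv X
  (fun x y => same_block a (inr x) (inr y))
  (fun=> same_block_refl _ _)
  (fun _ _ => @same_block_sym _ _ _ _)
  (fun _ _ _ => @same_block_trans _ _ _ _ _).

Lemma dom_cross a x x' y : dom a x x' -> cross a x' y -> cross a x y.
Proof. exact: same_block_trans. Qed.

Lemma cross_cod a x y y' : cross a x y -> cod a y y' -> cross a x y'.
Proof. exact: same_block_trans. Qed.

Lemma cross_dom a x x' y : cross a x y -> cross a x' y -> dom a x x'.
Proof. by move=> xy /same_block_sym; exact: same_block_trans. Qed.

Lemma cross_in_cod a x y y' : cross a x y -> cross a x y' -> cod a y y'.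
Proof. by move=> /same_block_sym; exact: same_block_trans. Qed.

(** An equation between products makes the kernel visible to morphisms. *)
Lemma idem_mulP E a : idem E * a = a <-> sub_eqv E (dom a).
Proof.
split=> [Ea x x' xx'|Ea].
  have [y x'y] := cross_total a x'.
  apply: cross_dom (x'y); rewrite -Ea; apply: cross_comp x'y.
  exact/cross_idem.
apply: IP_ext => x y; split.
  apply: cross_mul_least; first exact: cross_difun.
  by move=> {}x x' {}y /cross_idem/Ea; exact: dom_cross.
by apply: cross_comp; apply/cross_idem; exact: eqv_refl.
Qed.

Lemma mul_idemP E a : a * idem E = a <-> sub_eqv E (cod a).
Proof.
split=> [Ea y y' yy'|Ea].
  have [x xy] := cross_surj a y.
  apply: (cross_in_cod xy); rewrite -Ea; apply: cross_comp xy _.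
  exact/cross_idem.
apply: IP_ext => x y; split.
  apply: cross_mul_least; first exact: cross_difun.
  by move=> {}x x' {}y xx' /cross_idem/Ea; exact: cross_cod.
by move=> xy; apply: cross_comp xy _; apply/cross_idem; exact: eqv_refl.
Qed.

Lemma dom_idem E x y : dom (idem E) x y <-> E x y.
Proof.
split=> [xy|/cross_idem xy].
  exact/cross_idem/(dom_cross xy)/cross_idem/eqv_refl.
by apply: cross_dom xy _; apply/cross_idem/eqv_refl.
Qed.

Lemma idemM E : idem E * idem E = idem E.
Proof. by apply/idem_mulP => x y /dom_idem. Qed.

Lemma reflexive_idem a : (forall x, cross a x x) -> a = idem (dom a).
Proof.
move=> refl; apply: IP_ext => x y; rewrite cross_idem; split=> xy.
  exact: cross_dom xy (refl y).
exact: dom_cross xy (refl y).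
Qed.

Lemma idempotent_idem a : a * a = a -> a = idem (dom a).
Proof.
move=> aa; apply: reflexive_idem => x.
have trans u c v : cross a u c -> cross a c v -> cross a u v.
  by move=> uc cv; rewrite -aa; exact: cross_comp uc cv.
have [y xy] := cross_total a x; have [w wx] := cross_surj a x.
exact: cross_difun xy (trans _ _ _ wx xy) wx.
Qed.

End idempotents.

(** * Injective endomorphisms fixing the idempotents *)

Section idempotent_fixing.
Variables (X : Type) (psi : IP X -> IP X).
Hypothesis psiM : {morph psi : a b / a * b}.
Hypothesis psi_inj : injective psi.
Hypothesis psi_idem : forall E, psi (idem E) = idem E.
Implicit Types a b : IP X.

Let dom_psi a x y : dom (psi a) x y <-> dom a x y.
Proof.
rewrite -!(sub_pair_eqv x y) -!idem_mulP -{1}psi_idem -psiM.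
by split=> [/psi_inj|->].
Qed.

Let cod_psi a x y : cod (psi a) x y <-> cod a x y.
Proof.
rewrite -!(sub_pair_eqv x y) -!mul_idemP -{1}psi_idem -psiM.
by split=> [/psi_inj|->].
Qed.

(** Both sides are [a] with the block of [x], [y] and the block of [w], [z] merged. *)
Let pair_comm a x y w z : cross a x y -> cross a w z ->
  idem (pair_eqv x w) * a = a * idem (pair_eqv y z).
Proof.
move=> xy wz.
have pl s t : (s = x \/ s = w) /\ (t = x \/ t = w) ->
    cross (idem (pair_eqv x w)) s t.
  by move=> ?; apply/cross_idem; right.
have pr s t : (s = y \/ s = z) /\ (t = y \/ t = z) ->
    cross (idem (pair_eqv y z)) s t.
  by move=> ?; apply/cross_idem; right.
have rr s : cross (idem (pair_eqv y z)) s s by apply/cross_idem; left.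
have aP c v : cross a c v -> cross (a * idem (pair_eqv y z)) c v.
  by move=> cv; exact: cross_comp cv (rr v).
have Pa c v : cross a c v -> cross (idem (pair_eqv x w) * a) c v.
  by apply: cross_comp; apply/cross_idem; left.
apply: IP_ext => s t; split; apply: cross_mul_least; try exact: cross_difun.
- move=> {}s c {}t /cross_idem[->|[sP cP]] ct; first exact: aP.
  suff H u : u = x \/ u = w -> cross (a * idem (pair_eqv y z)) u z.
    exact: cross_difun (H _ sP) (H _ cP) (aP _ _ ct).
  by case=> ->; [apply: cross_comp xy _|apply: cross_comp wz _]; apply: pr; tauto.
- move=> {}s c {}t sc /cross_idem[<-|[cP tP]]; first exact: Pa.
  suff H u : u = y \/ u = z -> cross (idem (pair_eqv x w) * a) x u.
    exact: cross_difun (Pa _ _ sc) (H _ cP) (H _ tP).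
  by case=> ->; [apply: cross_comp xy|apply: cross_comp wz]; apply: pl; tauto.
Qed.

(** Apply [psi] to [pair_comm]. On the left [w] gets linked to [y'] through [x]; on the right only
    the classes of [y] and [z] merge. If the three classes differed, [psi a] would already link [w]
    to [y'], making [x], [w] and hence [y], [z] equivalent. *)
Let psi_cross a x y y' z : cross a x y -> cross (psi a) x y' ->
  [\/ cod a y y', cod a y z | cod a y' z].
Proof.
move=> xy xy'; apply: contrapT => H.
have [nyy' nyz ny'z] : [/\ ~ cod a y y', ~ cod a y z & ~ cod a y' z].
  by split=> ?; apply: H; [constructor 1|constructor 2|constructor 3].
have [w wz] := cross_surj a z.
have E : idem (pair_eqv x w) * psi a = psi a * idem (pair_eqv y z).
  rewrite -(psi_idem (pair_eqv x w)) -(psi_idem (pair_eqv y z)) -!psiM.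
  by rewrite (pair_comm xy wz).
have : cross (psi a * idem (pair_eqv y z)) w y'.
  rewrite -E; apply: cross_comp xy'; apply/cross_idem.
  by right; split; [right|left].
(* A difunctional relation keeping the block of [y'] apart; it contains the composition as neither
   [y] nor [z] lies in that block. *)
pose R s t := cross (psi a) s y' <-> cod a y' t.
move=> /(@cross_mul_least _ _ _ R) wy'.
have {}wy' : cross (psi a) w y'.
  apply/wy'; last exact: eqv_refl.
    by move=> s t s' t'; rewrite /R; tauto.
  move=> s c t sc ct; rewrite /R.
  have -> : cross (psi a) s y' <-> cod a y' c.
    rewrite -cod_psi; split=> [sy'|/eqv_sym]; first exact: cross_in_cod sy' sc.
    exact: cross_cod.
  move/cross_idem: ct => [->//|[cP tP]].
  have no u : u = y \/ u = z -> ~ cod a y' u by case=> -> // /eqv_sym.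
  by split=> h; [case: (no _ cP)|case: (no _ tP)].
have /dom_psi xw := cross_dom xy' wy'.
by apply: nyz; apply: cross_in_cod xy (dom_cross xw wz).
Qed.

Let psi_eq a : (forall x y, cross a x y -> cross (psi a) x y) -> psi a = a.
Proof.
move=> H; apply: IP_ext => x y; split=> [xy|/H//].
have [y1 xy1] := cross_total a x.
apply: (cross_cod xy1); apply/cod_psi; exact: cross_in_cod (H _ _ xy1) xy.
Qed.

(** If [psi] rematched a block, [psi_cross] would leave only two classes. *)
Let psi_rank3 a u v t : ~ cod a u v -> ~ cod a u t -> ~ cod a v t -> psi a = a.
Proof.
move=> uv ut vt; apply: psi_eq => x y xy.
have [y' xy'] := cross_total (psi a) x.
have [yy'|nyy'] := pselect (cod a y y').
  by apply: cross_cod xy' _; apply/cod_psi; exact: eqv_sym.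
have two z : cod a y z \/ cod a y' z.
  by case: (psi_cross z xy xy') => [//||]; [left|right].
have join c z z' : cod a c z -> cod a c z' -> cod a z z'.
  by move=> /eqv_sym; exact: eqv_trans.
by case: (two u) => hu; case: (two v) => hv; case: (two t) => ht; exfalso;
  eauto.
Qed.

Hypothesis X3 : exists x y z : X, [/\ x <> y, x <> z & y <> z].

Let big_class (E : eqv X) c d : ~ E c d -> (forall z, E c z \/ E d z) ->
  exists p q r, [/\ p <> q, E p q & ~ E p r].
Proof.
move=> ncd two; have [x [y [z [xy xz yz]]]] := X3.
have [p [q [pq Epq]]] : exists p q, p <> q /\ E p q.
  have join e s t : E e s -> E e t -> E s t.
    by move=> /eqv_sym; exact: eqv_trans.
  by case: (two x) => hx; case: (two y) => hy; case: (two z) => hz;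
    by [exists x, y; split=> //; apply: join hx hy
       |exists x, z; split=> //; apply: join hx hz
       |exists y, z; split=> //; apply: join hy hz].
exists p, q; have [pc|npc] := pselect (E p c); last by exists c.
by exists d; split=> // pd; apply: ncd; apply: eqv_trans pd; exact: eqv_sym.
Qed.

(* A bijection between two 2-block partitions that matches a block of size   *)
(* at least 2 with a block of size at least 2 coarsens one of rank 3.        *)
Let psi_big_blocks (E F : eqv X) p q r u v t b :
  p <> q -> E p q -> ~ E p r -> u <> v -> F u v -> ~ F u t ->
  (forall x y, cross b x y <-> (E p x <-> F u y)) -> psi b = b.
Proof.
move=> pq Epq npr uv Fuv nut bP.
(* The matched blocks are split into [p] with [u] and remainder with remainder; [q] and [v] keep the
   remainders nonempty, [r] and [t] the complements. Left multiplication by [idem E] merges the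
   pieces back into [b]. *)
pose R x y := (E p x <-> F u y) /\ (x = p <-> y = u).
have Rt x : exists y, R x y.
  have [->|xp] := pselect (x = p).
    by exists u; split=> //; split=> _; exact: eqv_refl.
  have [px|npx] := pselect (E p x).
    by exists v; split; split=> // /esym.
  by exists t; split; split=> // tu; case: nut; rewrite tu; exact: eqv_refl.
have Rs y : exists x, R x y.
  have [->|yu] := pselect (y = u).
    by exists p; split=> //; split=> _; exact: eqv_refl.
  have [uy|nuy] := pselect (F u y).
    by exists q; split; split=> // /esym.
  by exists r; split; split=> // rp; case: npr; rewrite rp; exact: eqv_refl.
have Rd : difunctional R by move=> x y z w; rewrite /R; tauto.
have [b0 b0P] := rel_IP Rt Rs Rd.
have codb0 y z : cod b0 y z -> (F u y <-> F u z) /\ (y = u <-> z = u).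
  move=> yz; have [x xy] := cross_surj b0 y.
  by have /b0P := cross_cod xy yz; move/b0P: xy; rewrite /R; tauto.
have b0_fix : psi b0 = b0.
  apply: (@psi_rank3 b0 u v t) => /codb0[].
  - by move=> _ [/(_ erefl)/esym].
  - by move=> [/(_ eqv_refl)].
  - by move=> [/(_ Fuv)].
suff -> : b = idem E * b0 by rewrite psiM psi_idem b0_fix.
apply: IP_ext => x y; rewrite bP; split; last first.
  apply: (@cross_mul_least _ _ _ (fun x y => E p x <-> F u y)).
    by move=> *; tauto.
  move=> {}x c {}y /cross_idem xc /b0P[<- _]; split=> h.
    exact: eqv_trans h xc.
  by apply: eqv_trans h _; exact: eqv_sym.
move=> pxuy.
suff [c xc cy] : exists2 c, E x c & R c y.
  by apply: (@cross_comp _ _ _ _ c); [apply/cross_idem|apply/b0P].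
have [px|npx] := pselect (E p x); last first.
  exists x; first exact: eqv_refl.
  split=> //; split=> e; exfalso; apply: npx; first by rewrite e; exact: eqv_refl.
  by apply/pxuy; rewrite e; exact: eqv_refl.
have uy := pxuy.1 px.
have [->|yu] := pselect (y = u).
  by exists p; [exact: eqv_sym|split=> //; split=> _; exact: eqv_refl].
exists q; first by apply: eqv_trans Epq; exact: eqv_sym.
by split; split=> // /esym.
Qed.

(** A bijection between two-block partitions is determined by one matched pair of blocks. *)
Let two_classes_cross (c : IP X) p u : cross c p u ->
  (exists d e : X, forall z, cod c d z \/ cod c e z) ->
  forall x y, cross c x y <-> (dom c p x <-> cod c u y).
Proof.
move=> pu [d [e two]] x y.
split=> [xy|h].
  split=> [px|uy].
    exact: cross_in_cod pu (dom_cross px xy).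
  exact: cross_dom (cross_cod pu uy) xy.
have [px|npx] := pselect (dom c p x).
  by apply: (dom_cross (eqv_sym px)); apply: cross_cod pu (h.1 px).
have [y1 xy1] := cross_total c x.
have nuy1 : ~ cod c u y1.
  by move=> uy1; apply: npx; exact: cross_dom (cross_cod pu uy1) xy1.
have nuy : ~ cod c u y by move/h.
apply: (cross_cod xy1).
have join f z z' : cod c f z -> cod c f z' -> cod c z z'.
  by move=> /eqv_sym; exact: eqv_trans.
by case: (two u) => hu; case: (two y) => hy; case: (two y1) => hy1;
  eauto; exfalso; eauto.
Qed.

Lemma idempotent_fixing_id a : psi a = a.
Proof.
apply: contrapT => na.
have [x [y [xy nxy]]] : exists x y, cross a x y /\ ~ cross (psi a) x y.
  apply: contrapT => H; apply: na; apply: psi_eq => x y xy.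
  by apply: contrapT => nxy; apply: H; exists x, y.
have [y' xy'] := cross_total (psi a) x.
have nyy' : ~ cod a y y'.
  by move=> yy'; apply: nxy; apply: cross_cod xy' _; apply/cod_psi; exact: eqv_sym.
have two z : cod a y z \/ cod a y' z.
  by case: (psi_cross z xy xy') => [//||]; [left|right].
have [x' x'y'] := cross_surj a y'.
have nxx' : ~ dom a x x'.
  by move=> xx'; apply: nyy'; apply: cross_in_cod xy (dom_cross xx' x'y').
have twod z : dom a x z \/ dom a x' z.
  have [w zw] := cross_total a z.
  case: (two w) => h; [left|right].
    exact: cross_dom (cross_cod xy h) zw.
  exact: cross_dom (cross_cod x'y' h) zw.
have x'y : cross (psi a) x' y.
  have [w x'w] := cross_total (psi a) x'.
  case: (two w) => h.
    by apply: cross_cod x'w _; apply/cod_psi; exact: eqv_sym.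
  exfalso; apply: nxx'; apply/dom_psi; apply: cross_dom (x'w).
  by apply: cross_cod xy' _; apply/cod_psi.
(* Of the two opposite matchings [a] and [psi a], one matches the large classes of [p] and [u], so
   it is fixed; if it is [psi a], injectivity fixes [a]. *)
have [p [q [r [pq Epq npr]]]] := big_class nxx' twod.
have [u [v [t [uv Fuv nut]]]] := big_class nyy' two.
have a_case : ~ cross a p u.
  move=> pu; apply: na; apply: (psi_big_blocks pq Epq npr uv Fuv nut).
  by apply: two_classes_cross => //; exists y, y'.
have psia_case : ~ cross (psi a) p u.
  move=> pu; apply: na; apply: psi_inj.
  apply: (psi_big_blocks pq Epq npr uv Fuv nut) => s w.
  rewrite (two_classes_cross pu) ?dom_psi ?cod_psi //.
  by exists y, y' => z; rewrite !cod_psi.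
have Ed := @dom_psi a; have Ec := @cod_psi a.
case: (twod p) => [/eqv_sym px|/eqv_sym px]; case: (two u) => yu.
- by apply: a_case; apply: dom_cross px (cross_cod xy yu).
- apply: psia_case; apply: (dom_cross ((Ed _ _).2 px)).
  by apply: (cross_cod xy'); apply/Ec.
- apply: psia_case; apply: (dom_cross ((Ed _ _).2 px)).
  by apply: (cross_cod x'y); apply/Ec.
- by apply: a_case; apply: dom_cross px (cross_cod x'y' yu).
Qed.

End idempotent_fixing.

(** * Inner automorphisms *)

Section conjugation.
Variable X : Type.
Implicit Types (a b : IP X) (g h : Sym X).

Lemma cross_perm g x y : cross (perm_IP g) x y <-> y = g x.
Proof.
split=> [[_ [z _ <-] [/= [[->]|//] [//|[->]]]]//|->].
by exists [set inl x; inr (g x)]; [exists x|split; [left|right]].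
Qed.

Lemma cross_perm_mul g a x y : cross (perm_IP g * a) x y <-> cross a (g x) y.
Proof.
split; last by apply: cross_comp; exact/cross_perm.
apply: (@cross_mul_least _ _ _ (fun x => cross a (g x))).
  by move=> ? ? ? ?; exact: cross_difun.
by move=> {}x c {}y /cross_perm ->.
Qed.

Lemma cross_mul_perm g a x y :
  cross (a * perm_IP g) x y <-> cross a x (g^-1 y).
Proof.
split; last first.
  by move=> xy; apply: cross_comp xy _; apply/cross_perm; rewrite sym_invVK.
apply: (@cross_mul_least _ _ _ (fun x y => cross a x (g^-1 y))).
  by move=> ? ? ? ?; exact: cross_difun.
by move=> {}x c {}y xc /cross_perm ->; rewrite sym_invK.
Qed.

Definition conj g a := perm_IP g^-1 * a * perm_IP g.

Lemma cross_conj g a x y : cross (conj g a) x y <-> cross a (g^-1 x) (g^-1 y).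
Proof. by rewrite cross_mul_perm cross_perm_mul. Qed.

Lemma conjM g : {morph conj g : a b / a * b}.
Proof.
move=> a b; rewrite /conj -!mulgA; congr (_ * (_ * _)).
by apply: IP_ext => x y; rewrite !cross_perm_mul sym_invK.
Qed.

Lemma conjK g : cancel (conj g) (conj g^-1).
Proof.
by move=> a; apply: IP_ext => x y; rewrite !cross_conj invgK !sym_invK.
Qed.

Lemma conjVK g : cancel (conj g^-1) (conj g).
Proof. by have := conjK g^-1; rewrite invgK. Qed.

Lemma conj_comp g h a : conj h (conj g a) = conj (g * h) a.
Proof. by apply: IP_ext => x y; rewrite !cross_conj invgM. Qed.

Lemma conj_is_morph g : is_morph (MkSym (Bijective (conjK g) (conjVK g))).
Proof. exact/asboolP/conjM. Qed.

Definition conj_Aut g : Aut (IP X) := MkAut (conj_is_morph g).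

(** Equal conjugates of the pair idempotents show that [g] followed by the inverse of [h] preserves
    every pair. *)
Lemma conj_faithful g h :
  (exists x y z : X, [/\ x <> y, x <> z & y <> z]) ->
  (forall a, conj g a = conj h a) -> g = h.
Proof.
move=> X3 gh; apply: sym_eq => x.
apply: (can_inj (sym_invVK h)); rewrite sym_invK.
apply: (@pair_eqv_fixed X (fun x => (h^-1%g : Sym X) (g x))) => // [u v|u v].
  by move=> /(can_inj (sym_invVK h))/(can_inj (sym_invK g)).
apply/cross_idem/cross_conj; rewrite -gh; apply/cross_conj.
by rewrite !sym_invK; apply/cross_idem; right; split; [left|right].
Qed.

End conjugation.

(** * Automorphisms of IP_X on at least three points, and on two *)

Section automorphisms.
Variable X : Type.
Implicit Types (a b : IP X) (phi : Aut (IP X)).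

Lemma Aut_morph phi : {morph phi : a b / a * b}.
Proof. by have /asboolP := AutvalP phi. Qed.

Lemma AutK phi : cancel phi (phi^-1%g : Aut (IP X)).
Proof. exact: (sym_invK (Autval phi)). Qed.

Lemma AutVK phi : cancel (phi^-1%g : Aut (IP X)) phi.
Proof. exact: (sym_invVK (Autval phi)). Qed.

Lemma Aut_ext phi (psi : Aut (IP X)) : phi =1 psi -> phi = psi.
Proof. by move=> E; apply: val_inj; exact: sym_eq. Qed.

Lemma Aut_idem phi E : phi (idem E) = idem (dom (phi (idem E))).
Proof. by apply: idempotent_idem; rewrite -Aut_morph idemM. Qed.

(** By [idem_mulP] containment is an equation between products, which an automorphism and its
    inverse carry back and forth. *)
Lemma Aut_eqv_iso phi : eqv_iso (fun E => dom (phi (idem E)))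
  (fun E => dom ((phi^-1%g : Aut (IP X)) (idem E))).
Proof.
have H (f k : Aut (IP X)) E F : cancel f k -> cancel k f ->
    sub_eqv (dom (f (idem E))) F <-> sub_eqv E (dom (k (idem F))).
  move=> fk kf.
  have -> : sub_eqv (dom (f (idem E))) F <->
            sub_eqv (dom (f (idem E))) (dom (idem F)).
    by split=> EF x y /EF /dom_idem.
  rewrite -!idem_mulP -Aut_idem; split=> EF.
    by rewrite -{1}(fk (idem E)) -Aut_morph EF.
  by rewrite -(kf (idem F)) -Aut_morph EF.
by split=> E F; apply: H; [exact: AutK|exact: AutVK|exact: AutVK|exact: AutK].
Qed.

Lemma Aut_inner_ge3 phi :
  (exists x y z : X, [/\ x <> y, x <> z & y <> z]) ->
  exists g, forall a, phi a = conj g a.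
Proof.
move=> X3; have [g gP] := eqv_iso_perm X3 (Aut_eqv_iso phi).
exists g => a; apply: (can_inj (conjVK g)); rewrite conjK.
apply: (idempotent_fixing_id (psi := fun a => conj g^-1 (phi a))) => //.
- by move=> b c; rewrite Aut_morph conjM.
- by move=> b c /(can_inj (conjVK g))/(can_inj (AutK phi)).
- move=> E; apply: IP_ext => x y.
  by rewrite cross_conj invgK Aut_idem !cross_idem gP.
Qed.

Lemma Aut_id_eq2 phi x y : x <> y -> (forall z : X, z = x \/ z = y) ->
  forall a, phi a = a.
Proof.
move=> xy two a.
(* A non-idempotent is the transposition: one point related to its own copy would force the same for
   the other. *)
have nonidem b : b * b <> b -> forall s t, cross b s t <-> s <> t.
  move=> nb.
  have irr s : ~ cross b s s.
    move=> ss; apply: nb; have refl t : cross b t t.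
      have [->//|ts] := pselect (t = s).
      have st v : v = s \/ v = t.
        by case: (two s) (two t) (two v); intuition congruence.
      have [v tv] := cross_total b t; have [w wt] := cross_surj b t.
      case: (st v) => vE; subst v => //; case: (st w) => wE; subst w => //.
      exact: cross_difun tv ss wt.
    by rewrite (reflexive_idem refl) idemM.
  move=> s t; split=> [+ st|st]; first by rewrite st => /irr.
  have [v sv] := cross_total b s.
  suff -> : t = v by [].
  have : s <> v by move=> E; apply: (irr s); rewrite {2}E.
  by case: (two s) (two t) (two v); intuition congruence.
pose one := idem (kernel (@id X)).
have mul1 b : one * b = b.
  by apply/idem_mulP => s t /= ->; exact: same_block_refl.
have mulr1 b : b * one = b.
  by apply/mul_idemP => s t /= ->; exact: same_block_refl.
have phi1 : phi one = one.
  by rewrite -[LHS]mulr1 -{2}(AutVK phi one) -Aut_morph mul1 AutVK.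
(* The equality relation and the full relation are the only equivalences on two points. *)
have full b : b * b = b -> b <> one -> forall s t, cross b s t.
  move=> bb b1 s t; apply: contrapT => st; apply: b1.
  rewrite (idempotent_idem bb); apply: IP_ext => u v; rewrite !cross_idem.
  move: st; rewrite (idempotent_idem bb) cross_idem => st.
  split=> [/dom_idem uv|/= ->]; last exact: same_block_refl.
  have ts : ~ dom b t s by move=> /eqv_sym.
  have stn : s <> t by move=> E; apply: st; rewrite E; exact: eqv_refl.
  apply: contrapT => /= nuv.
  by case: (two s) => ?; case: (two t) => ?; case: (two u) => ?;
    case: (two v) => ?; congruence.
have [aa|aa] := pselect (a * a = a); last first.
  apply: IP_ext => s t; rewrite !nonidem // -Aut_morph => /(can_inj (AutK phi)).
  exact: aa.
have [->//|a1] := pselect (a = one).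
apply: IP_ext => s t; split=> _; apply: full => //.
  by rewrite -Aut_morph aa.
by rewrite -[in X in _ <> X]phi1 => /(can_inj (AutK phi)).
Qed.

End automorphisms.

(** * Small sets and the conclusion *)

Lemma IP_subsingleton (X : Type) (a b : IP X) :
  (forall x y : X, x = y) -> a = b.
Proof.
move=> X1; apply: IP_ext => x y.
have [y1 h1] := cross_total a x; have [y2 h2] := cross_total b x.
by rewrite (X1 y1 y) in h1; rewrite (X1 y2 y) in h2.
Qed.

Lemma small_cases (X : Type) :
  [\/ exists x y z : X, [/\ x <> y, x <> z & y <> z],
      exists x y : X, x <> y /\ (forall z, z = x \/ z = y)
    | forall x y : X, x = y].
Proof.
have [X3|X3] := pselect (exists x y z : X, [/\ x <> y, x <> z & y <> z]).
  by constructor 1.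
have [[x [y xy]]|X2] := pselect (exists x y : X, x <> y).
  constructor 2; exists x, y; split=> // z.
  apply: contrapT => /not_orP[zx zy]; apply: X3.
  by exists x, y, z; split=> //; exact: nesym.
constructor 3 => x y; apply: contrapT => xy; apply: X2; by exists x, y.
Qed.

Lemma Aut_inner (X : Type) (phi : Aut (IP X)) :
  exists g, forall a, phi a = conj g a.
Proof.
have [X3|[x [y [xy two]]]|X1] := small_cases X; first exact: Aut_inner_ge3.
- exists 1 => a; rewrite (Aut_id_eq2 phi xy two).
  by apply: IP_ext => s t; rewrite cross_conj invg1.
- by exists 1 => a; exact: IP_subsingleton.
Qed.

(** Two points are excluded because conjugation by their transposition is trivial. *)
Lemma conj_inj (X : Type) (g h : Sym X) : [set: X] #!= `I_2 ->
  (forall a, conj g a = conj h a) -> g = h.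
Proof.
move=> X2; have [X3|[x [y [xy two]]]|X1] := small_cases X.
- exact: conj_faithful.
- case/negP: X2; apply/card_set_bijP.
  exists (fun z => if pselect (z = x) then 0%N else 1%N).
  split=> [z _|z z' _ _|].
  + by case: pselect.
  + by case: (two z) (two z') => -> [] ->; repeat case: pselect => //=; congruence.
  + case=> [|[|//]] _; first by exists x => //; case: pselect.
    by exists y => //; case: pselect => // yx; case: xy.
- by move=> _; apply: sym_eq => x; exact: X1.
Qed.

Theorem theorem4 (X : Type) :
  (forall phi : Aut (IP X), exists g : Sym X,
     forall a : IP X, phi a = perm_IP g^-1 * a * perm_IP g) /\
  ([set: X] #!= `I_2 -> group_isomorphic (Aut (IP X)) (Sym X)) /\
  (forall phi : Aut (IP 'I_2), phi = 1).
Proof.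
split; first exact: Aut_inner.
split=> [X2|phi].
  have [f fP] := choice (@Aut_inner X).
  have fM : {morph f : phi psi / phi * psi}.
    (* Automorphisms and permutations both compose from left to right, so [f] preserves the order of
       factors. *)
    move=> phi psi; apply: conj_inj X2 _ => a.
    by rewrite -conj_comp -!fP.
  pose fm := isMultiplicative.Build _ _ f fM.
  exists (HB.pack_for {multiplicative Aut (IP X) -> Sym X} f fm).
  exists (@conj_Aut X) => [phi|g].
    by apply: Aut_ext => a; exact: esym (fP phi a).
  by apply: conj_inj X2 _ => a; exact: esym (fP (conj_Aut g) a).
apply: Aut_ext => a.
apply: (@Aut_id_eq2 _ phi ord0 ord_max) => // -[[|[|//]] i].
  by left; exact: val_inj.
by right; exact: val_inj.
Qed.
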